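(* Let $u$ be a primitive word over $V$. Then $u$ is a non-ins-robust primitive word (i.e. $u \in Q_{\overline{I}}$) if and only if the word $uu$ has a factor of length $|u|$ that has a period $p$ with $p$ dividing $|u| + 1$ and $p \le |u|$.
   Context: $V$ is a finite alphabet with at least two distinct letters; $V^*$ is the set of all finite words over $V$, $|w|$ is the length of $w$. A factor of a word $w$ is a word $y$ with $w = xyz$ for some $x, z \in V^*$. A word $a_1 a_2 \cdots a_n$ ($a_i \in V$) has period $p$ (a positive integer) if $a_i = a_{i+p}$ for all $1 \le i \le n - p$. A nonempty word $w$ is primitive if it is not of the form $v^n$ for a word $v$ and an integer $n \ge 2$; $Q$ is the set of primitive words. For a word $w$ of length $n$, $w[1..i]$ denotes its prefix of length $i$ and $w[i+1..n]$ its suffix of length $n-i$. A primitive word $w$ of length $n$ is ins-robust if for every $i \in \{0,\ldots,n\}$ and every $a \in V$ the word $w[1..i]\,a\,w[i+1..n]$ is primitive; $Q_I$ is the set of ins-robust primitive words and $Q_{\overline{I}} = Q \setminus Q_I$. *)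

(* Defs.v *)
From mathcomp Require Import all_boot.

Set Implicit Arguments.
Unset Strict Implicit.
Unset Printing Implicit Defensive.

Definition word_pow (V : Type) (v : seq V) (n : nat) : seq V :=
  flatten (nseq n v).

(* Positions are 0-based: a_(i+1) = a_(i+1+p) for i + 1 <= size w - p. *)
Definition has_period (V : Type) (w : seq V) (p : nat) : Prop :=
  0 < p /\ forall i, i + p < size w -> onth w i = onth w (i + p).

Definition primitive_word (V : Type) (w : seq V) : Prop :=
  w <> [::] /\ ~ exists (v : seq V) (n : nat), 2 <= n /\ w = word_pow v n.

Definition insert_letter (V : Type) (w : seq V) (i : nat) (a : V) : seq V :=
  take i w ++ [:: a] ++ drop i w.

Definition ins_robust (V : Type) (w : seq V) : Prop :=
  primitive_word w /\
  forall i a, i <= size w -> primitive_word (insert_letter w i a).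

Definition non_ins_robust (V : Type) (w : seq V) : Prop :=
  primitive_word w /\ ~ ins_robust w.

(* Main.v *)
Require Import Defs.
From mathcomp Require Import all_boot.

Set Implicit Arguments.
Unset Strict Implicit.
Unset Printing Implicit Defensive.

(** A nonempty word is a proper power iff it is fixed by rotation by some proper
    divisor of its length. Rotations commute, so being a proper power is
    invariant under rotation. Inserting [a] into [u] at position [i] gives a
    rotation of [rcons (rot i u) a], and the words [rot i u] are exactly the
    factors of [uu] of length [|u|]; when such a factor has period [p] dividing
    [|u| + 1], the letter [a] can be chosen to continue that period. *)

Definition rot_fixed_by_divisor (T : eqType) (w : seq T) : bool :=
  [exists d : 'I_(size w), [&& 0 < d, d %| size w & rot d w == w]].

Lemma word_powSr (T : Type) (x : seq T) k :
  word_pow x k ++ x = word_pow x k.+1.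
Proof.
by elim: k => [|k IH]; rewrite /word_pow /= ?cats0 // -catA [_ ++ x]IH.
Qed.

Lemma size_word_pow (T : Type) (x : seq T) k :
  size (word_pow x k) = k * size x.
Proof. by elim: k => // k IH; rewrite /word_pow /= size_cat [X in _ + X]IH. Qed.

(** Once [z] is at least as long as [x], it begins with [x]; cancelling this [x] leaves a remainder
    that is again a prefix of [x] followed by itself, so induction on [k] applies. *)
Lemma word_pow_of_prefix (T : Type) (x z : seq T) k :
  z = take (size z) (x ++ z) -> size z = k * size x -> z = word_pow x k.
Proof.
elim: k z => [|k IH] z zE sz; first by move/size0nil: sz.
have le_xz : size x <= size z by rewrite sz mulSn leq_addr.
have zx : z = x ++ drop (size x) z.
  rewrite -{1}(cat_take_drop (size x) z); congr (_ ++ _).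
  by rewrite zE take_takel // take_size_cat.
rewrite zx; congr (_ ++ _).
have sz' : size (drop (size x) z) = k * size x.
  by rewrite size_drop sz mulSn addKn.
apply: IH => //.
rewrite {1}zE take_cat ltnNge le_xz /= drop_size_cat //.
by rewrite size_drop {2}zx.
Qed.

Lemma onth_lt (T : Type) (x0 : T) (s : seq T) n :
  n < size s -> onth s n = Some (nth x0 s n).
Proof. by move=> lt_ns; rewrite onthE (nth_map x0). Qed.

Lemma drop_take_of_period (T : Type) (w : seq T) p :
  has_period w p -> drop p w = take (size w - p) w.
Proof.
move=> [p_gt0 wP]; case: w wP => // x0 s; set w := x0 :: s => wP.
apply: (@eq_from_nth _ x0) => [|i].
  by rewrite size_drop size_takel // leq_subr.
rewrite size_drop => lt_i; rewrite nth_drop nth_take //.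
have lt_ip : i + p < size w by rewrite addnC -ltn_subRL.
have := wP _ lt_ip; rewrite !(onth_lt x0) ?(leq_ltn_trans (leq_addr p i)) //.
by rewrite addnC => -[].
Qed.

(** Cut [w] after its first [p] letters [x], leaving [z]. The period makes [z] a prefix of
    [w = x ++ z], so [z] is a power of [x]. *)
Lemma word_pow_of_period (T : Type) (w : seq T) p :
  has_period w p -> p %| size w -> p <= size w ->
  w = word_pow (take p w) (size w %/ p).
Proof.
move=> wP /dvdnP[k sz] le_pw; have p_gt0 : 0 < p by case: wP.
have stk : size (take p w) = p by rewrite size_takel.
case: k sz => [|k] sz; first by move: le_pw; rewrite sz leqNgt p_gt0.
rewrite {1}sz mulnK // -{1}(cat_take_drop p w); congr (_ ++ _).
apply: word_pow_of_prefix.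
  by rewrite cat_take_drop size_drop -drop_take_of_period.
by rewrite size_drop stk sz mulSn addKn.
Qed.

Lemma rot_word_pow (T : Type) (x : seq T) k :
  rot (size x) (word_pow x k) = word_pow x k.
Proof.
case: k => [|k]; first by rewrite /word_pow.
by rewrite {1}/word_pow /= rot_size_cat [LHS]word_powSr.
Qed.

Lemma rot_of_period (T : Type) (w : seq T) p :
  has_period w p -> p %| size w -> p <= size w -> rot p w = w.
Proof.
move=> wP dvd le_pw; have wE := word_pow_of_period wP dvd le_pw.
rewrite [in LHS]wE -[p in rot p _](size_takel le_pw) rot_word_pow.
exact: esym wE.
Qed.

(** For [i + p < size w], position [i] of [rot p w] falls in its [drop p w] part and so holds letter
    [i + p] of [w]. *)
Lemma has_period_of_rot (T : Type) (w : seq T) p :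
  0 < p -> rot p w = w -> has_period w p.
Proof.
move=> p_gt0 wE; split=> // i lt_ip.
case: w wE lt_ip => // x0 s; set w := x0 :: s => wE lt_ip.
rewrite !(onth_lt x0) ?(leq_ltn_trans (leq_addr p i)) //; congr Some.
by rewrite -[in LHS]wE nth_cat size_drop ltn_subRL addnC lt_ip nth_drop addnC.
Qed.

Lemma has_period_catl (T : Type) (y z : seq T) p :
  has_period (y ++ z) p -> has_period y p.
Proof.
move=> [p_gt0 yP]; split=> // i lt_ip; have := yP i.
rewrite size_cat ltn_addr // => /(_ isT).
by rewrite !onth_cat lt_ip (leq_ltn_trans (leq_addr p i)).
Qed.

(** The only new pair to compare is the appended letter and the one [p] places before it, of which
    it is a copy. Since [0 < p <= size y], that index lies inside [y] and the default [x0] is never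
    read. *)
Lemma has_period_rcons (T : Type) (x0 : T) (y : seq T) p :
  has_period y p -> p <= size y ->
  has_period (rcons y (nth x0 y (size y - p))) p.
Proof.
move=> [p_gt0 yP] le_py; split=> // i.
rewrite size_rcons ltnS leq_eqVlt => /predU1P[ipE | lt_ip].
  rewrite !(onth_lt x0) ?size_rcons ?ipE ?ltnS -?ipE ?leq_addr //.
  rewrite ipE !nth_rcons ltnn eqxx -ipE addnK.
  by rewrite -[X in X < _]addn0 ltn_add2l p_gt0.
by rewrite -cats1 !onth_cat lt_ip (leq_ltn_trans (leq_addr p i)) // yP.
Qed.

Lemma rot_fixed_by_divisorP (T : eqType) (w : seq T) : w <> [::] ->
  reflect (exists (v : seq T) (n : nat), 2 <= n /\ w = word_pow v n)
          (rot_fixed_by_divisor w).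
Proof.
move=> w_neq0; have w_gt0 : 0 < size w by case: w w_neq0.
apply: (iffP existsP) => [[d /and3P[d_gt0 dvd /eqP wE]] | [v [n [n_ge2 wE]]]].
  exists (take d w), (size w %/ d); split.
    by rewrite ltn_divRL // mul1n.
  apply: word_pow_of_period => //; last exact: ltnW.
  exact: has_period_of_rot.
(* Conversely, the divisor is [size v]: it is positive because [w] is nonempty, and less than
   [size w] because [n >= 2]. *)
have sz : size w = n * size v by rewrite wE size_word_pow.
have v_gt0 : 0 < size v by move: w_gt0; rewrite sz muln_gt0 => /andP[].
have lt_vw : size v < size w by rewrite sz ltn_Pmull.
exists (Ordinal lt_vw); rewrite /= v_gt0 [in size w]sz dvdn_mull //=.
by rewrite wE rot_word_pow.
Qed.

Lemma rot_fixed_by_divisor_rot (T : eqType) j (w : seq T) :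
  rot_fixed_by_divisor (rot j w) = rot_fixed_by_divisor w.
Proof.
rewrite /rot_fixed_by_divisor size_rot; apply: eq_existsb => d.
by rewrite rot_rot (inj_eq (@rot_inj j T)).
Qed.

(** Rotating by [i.+1] rather than [i] moves the inserted letter along with the prefix, so that it
    ends up last. *)
Lemma rot_insert_letter (T : Type) (u : seq T) i a : i <= size u ->
  rot i.+1 (insert_letter u i a) = rcons (rot i u) a.
Proof.
move=> le_iu; rewrite /insert_letter catA.
have <- : size (take i u ++ [:: a]) = i.+1.
  by rewrite size_cat size_takel // addn1.
by rewrite rot_size_cat catA cats1.
Qed.

Lemma size_insert_letter (T : Type) (u : seq T) i a :
  size (insert_letter u i a) = (size u).+1.
Proof. by rewrite !size_cat addnCA -size_cat cat_take_drop. Qed.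

Lemma infix_rot (T : eqType) (u : seq T) i : infix (rot i u) (u ++ u).
Proof.
apply/infixP; exists (take i u), (drop i u).
by rewrite /rot -catA cat_take_drop catA cat_take_drop.
Qed.

Lemma infix_cat_self_rot (T : eqType) (u y : seq T) :
  infix y (u ++ u) -> size y = size u ->
  exists2 i, i <= size u & y = rot i u.
Proof.
move=> /infixP[s [t uuE]] sz.
have le_su : size s <= size u.
  have /(congr1 size) := uuE; rewrite !size_cat sz addnCA => /addnI ->.
  exact: leq_addr.
exists (size s) => //.
(* Cut the window of length [size u] starting at [size s] out of both sides: one side gives [y], the
   other a suffix of [u] followed by a prefix. If [size s = size u], the window is the second copy
   of [u]. *)
have := congr1 (take (size u) \o drop (size s)) uuE => /=.
rewrite (drop_size_cat _ (erefl (size s))) -sz take_size_cat // => <-.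
rewrite drop_cat sz /rot; case: ltngtP le_su => // [lt_su | ->] _.
  rewrite take_cat size_drop ltnNge leq_subr /= subKn //; exact: ltnW.
by rewrite subnn drop0 drop_size take_size.
Qed.

Theorem theorem25 (V : finType) (hV : 2 <= #|V|) (u : seq V)
    (hu : primitive_word u) :
  non_ins_robust u <->
  exists y : seq V,
    [/\ infix y (u ++ u), size y = size u
      & exists p : nat,
          [/\ has_period y p, p %| (size u).+1 & p <= size u]].
Proof.
have ins_neq0 i a : insert_letter u i a <> [::].
  by move/(congr1 size); rewrite size_insert_letter.
split=> [[_ not_rob] | [y [y_uu sz [p [yP dvd le_pu]]]]].
  (* Positions and letters are finite in number and the power test is boolean, so this case split is
     decidable. *)
  have [/existsP[i /existsP[a /existsP[[d lt_d] /=]]] | no_ins] := boolP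
      [exists i : 'I_(size u).+1, exists a,
         rot_fixed_by_divisor (insert_letter u i a)].
    have le_iu : i <= size u by rewrite -ltnS.
    rewrite size_insert_letter => /and3P[d_gt0 dvd /eqP fixd].
    exists (rot i u); split; [exact: infix_rot | exact: size_rot | exists d].
    split=> //; last by move: lt_d; rewrite size_insert_letter ltnS.
    (* The factor [rot i u] is a prefix of [rcons (rot i u) a], a rotation of the inserted word and
       hence also fixed by [rot d]. *)
    apply: (@has_period_catl _ _ [:: a]); rewrite cats1 -rot_insert_letter //.
    by apply: has_period_of_rot => //; rewrite rot_rot fixd.
  case: not_rob; split=> // i a le_iu; split; first exact: ins_neq0.
  move/(rot_fixed_by_divisorP (ins_neq0 i a)) => fix_ia; case/negP: no_ins.
  have lt_i : i < (size u).+1 by [].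
  by apply/existsP; exists (Ordinal lt_i); apply/existsP; exists a.
split=> // -[_ rob].
have [i le_iu yE] := infix_cat_self_rot y_uu sz.
(* A primitive word is nonempty, so some letter is available as the default for [nth]. *)
have x0 : V by case: (u) hu.1 => [/(_ erefl) [] | x0 _ _].
set a := nth x0 y (size y - p).
have [_] := rob i a le_iu; apply.
apply/(rot_fixed_by_divisorP (ins_neq0 i a)).
rewrite -(rot_fixed_by_divisor_rot i.+1) rot_insert_letter // -yE.
have lt_p : p < size (rcons y a) by rewrite size_rcons sz ltnS.
apply/existsP; exists (Ordinal lt_p); rewrite /= yP.1.
have dvd' : p %| size (rcons y a) by rewrite size_rcons sz.
rewrite dvd' /=; apply/eqP/rot_of_period => //; last exact: ltnW.
by apply: has_period_rcons; rewrite ?sz.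
Qed.
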